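(* Let $(A,\circ_A)$ be an anti-pre-Lie algebra and suppose there is an anti-pre-Lie algebra structure $(A^*,\circ_{A^*})$ on the dual space $A^*$. Let $(\mathfrak g(A),[-,-]_A)$ and $(\mathfrak g(A^* ),[-,-]_{A^*})$ be the sub-adjacent Lie algebras. Let $\delta:A\to A\otimes A$ and $\beta:A^*\to A^*\otimes A^*$ be the linear duals of $\circ_{A^*}$ and $\circ_A$ respectively. Then the following conditions are equivalent: (1) $(A,\circ_A,\delta)$ is an anti-pre-Lie bialgebra. (2) $\delta$ is a 1-cocycle of $(\mathfrak g(A),[-,-]_A)$ associated to $-\mathcal L_{\circ_A}\otimes\mathrm{id}+\mathrm{id}\otimes\mathrm{ad}_A$ (on $A\otimes A$), and $\beta$ is a 1-cocycle of $(\mathfrak g(A^* ),[-,-]_{A^*})$ associated to $-\mathcal L_{\circ_{A^*}}\otimes\mathrm{id}+\mathrm{id}\otimes\mathrm{ad}_{A^*}$ (on $A^*\otimes A^*$). (3) $(\mathfrak g(A),\mathfrak g(A^* ),-\mathcal L^*_{\circ_A},-\mathcal L^*_{\circ_{A^*}})$ is a matched pair of Lie algebras.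
   Context: All vector spaces and algebras are finite-dimensional over an algebraically closed field $\mathbb K$ of characteristic zero. Anti-pre-Lie algebra: a vector space $A$ with a bilinear operation $\circ$ such that, with $[x,y]=x\circ y-y\circ x$, for all $x,y,z$: $x\circ(y\circ z)-y\circ(x\circ z)=[y,x]\circ z$ and $[x,y]\circ z+[y,z]\circ x+[z,x]\circ y=0$. Then $[-,-]$ is a Lie bracket; $(\mathfrak g(A),[-,-])$ is the sub-adjacent Lie algebra. Notation: $\mathcal L_\circ(x)y=x\circ y=\mathcal R_\circ(y)x$, $\mathrm{ad}(x)y=[x,y]$. For a linear map $\rho:A\to\mathrm{End}(V)$, $\rho^*:A\to\mathrm{End}(V^* )$ is defined by $\langle\rho^*(x)u^*,v\rangle=-\langle u^*,\rho(x)v\rangle$. Linear duals: $\langle a^*\circ_{A^*}b^*,x\rangle=\langle a^*\otimes b^*,\delta(x)\rangle$ and $\langle x\circ_A y,a^*\rangle=\langle x\otimes y,\beta(a^* )\rangle$. Let $\tau(x\otimes y)=y\otimes x$ and $\xi(x\otimes y\otimes z)=y\otimes z\otimes x$. An anti-pre-Lie coalgebra $(A,\delta)$ is a vector space with a linear map $\delta:A\to A\otimes A$ satisfying $(\mathrm{id}^{\otimes3}-\tau\otimes\mathrm{id})(\mathrm{id}\otimes\delta)\delta=(\tau\otimes\mathrm{id}-\mathrm{id}^{\otimes3})(\delta\otimes\mathrm{id})\delta$ and $(\mathrm{id}^{\otimes3}+\xi+\xi^2)(\tau\otimes\mathrm{id}-\mathrm{id}^{\otimes3})(\delta\otimes\mathrm{id})\delta=0$.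 An anti-pre-Lie bialgebra $(A,\circ,\delta)$ consists of an anti-pre-Lie algebra $(A,\circ)$ and an anti-pre-Lie coalgebra $(A,\delta)$ such that for all $x,y\in A$: $(\mathrm{id}^{\otimes2}-\tau)\Big(\delta(x\circ y)-(\mathcal L_\circ(x)\otimes\mathrm{id})\delta(y)-(\mathrm{id}\otimes\mathcal L_\circ(x))\delta(y)+(\mathrm{id}\otimes\mathcal R_\circ(y))\delta(x)\Big)=0$, $\delta([x,y])=(\mathrm{id}\otimes\mathrm{ad}(x)-\mathcal L_\circ(x)\otimes\mathrm{id})\delta(y)-(\mathrm{id}\otimes\mathrm{ad}(y)-\mathcal L_\circ(y)\otimes\mathrm{id})\delta(x)$. A 1-cocycle of a Lie algebra $\mathfrak g$ associated to a representation $(\rho,V)$ is a linear map $f:\mathfrak g\to V$ with $f([x,y])=\rho(x)f(y)-\rho(y)f(x)$. (For an anti-pre-Lie algebra, $-\mathcal L_\circ$ and $\mathrm{ad}$ are representations of the sub-adjacent Lie algebra on $A$.) Matched pair of Lie algebras $(\mathfrak g,\mathfrak h,\rho_{\mathfrak g},\rho_{\mathfrak h})$: $\rho_{\mathfrak g}:\mathfrak g\to\mathfrak{gl}(\mathfrak h)$ and $\rho_{\mathfrak h}:\mathfrak h\to\mathfrak{gl}(\mathfrak g)$ are representations such that for $x,y\in\mathfrak g$, $a,b\in\mathfrak h$: $\rho_{\mathfrak g}(x)[a,b]-[\rho_{\mathfrak g}(x)a,b]-[a,\rho_{\mathfrak g}(x)b]+\rho_{\mathfrak g}(\rho_{\mathfrak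 h}(a)x)b-\rho_{\mathfrak g}(\rho_{\mathfrak h}(b)x)a=0$, $\rho_{\mathfrak h}(a)[x,y]-[\rho_{\mathfrak h}(a)x,y]-[x,\rho_{\mathfrak h}(a)y]+\rho_{\mathfrak h}(\rho_{\mathfrak g}(x)a)y-\rho_{\mathfrak h}(\rho_{\mathfrak g}(y)a)x=0$. *)

(* Defs.v *)
From HB Require Import structures.
From mathcomp Require Import all_boot all_order all_algebra.

Set Implicit Arguments.
Unset Strict Implicit.
Unset Printing Implicit Defensive.

Import GRing.Theory.
Local Open Scope ring_scope.

Definition bilinear_map (K : fieldType) (U V W : lmodType K)
    (b : U -> V -> W) : Prop :=
  (forall u, linear (b u)) /\ (forall v, linear (fun u => b u v)).

Definition dual (K : fieldType) (V : vectType K) : Type := 'Hom(V, K^o).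
HB.instance Definition _ (K : fieldType) (V : vectType K) :=
  Vector.copy (dual V) 'Hom(V, K^o).

Section Dual.
Variables (K : fieldType) (V : vectType K).

Definition ev (v : V) (u : dual V) : K := u v.

Definition bidual (v : V) : dual (dual V) := linfun (ev v : dual V -> K^o).

(* [bidual] is bijective (lemmas below); this is its inverse, through which
   the bidual is identified with V. *)
Definition unbidual : dual (dual V) -> V := (linfun bidual)^-1%VF.

(* <rho^*(x) u, v> = - <u, rho(x) v>; only meaningful when each [rho x] is
   linear. *)
Definition dual_rep (g : Type) (rho : g -> V -> V) (x : g) (u : dual V) :
    dual V :=
  linfun ((fun v => - u (rho x v)) : V -> K^o).

Lemma linfunE (U W : vectType K) (f : U -> W) : linear f -> linfun f =1 f.
Proof.
move=> f_lin; pose F := GRing.isLinear.Build _ _ _ _ _ f_lin.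
by pose f' : {linear U -> W} := HB.pack f F; exact: (lfunE f').
Qed.

Lemma dual_repE (g : Type) (rho : g -> V -> V) x u v :
  linear (rho x) -> dual_rep rho x u v = - u (rho x v).
Proof.
move=> rho_lin; apply: linfunE => a y z.
by rewrite rho_lin linearP opprD scalerN.
Qed.

Lemma bidualE v u : bidual v u = u v.
Proof. by apply: linfunE => a y z; rewrite /ev add_lfunE scale_lfunE. Qed.

Lemma bidual_linear : linear bidual.
Proof.
move=> a y z; apply/lfunP => u.
by rewrite add_lfunE scale_lfunE !bidualE linearP.
Qed.

Lemma lker_bidual : lker (linfun bidual) == 0%VS.
Proof.
apply/lker0P => y z; rewrite !(linfunE bidual_linear) => eq_yz.
rewrite (coord_vbasis (memvf y)) (coord_vbasis (memvf z)).
apply: eq_bigr => i _; congr (_ *: _).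
set c : dual V := linfun (coord (vbasis fullv) i : {linear V -> K^o}).
have := congr1 (fun h : dual (dual V) => h c) eq_yz.
by rewrite !bidualE /c !lfunE.
Qed.

Lemma bidualK : cancel bidual unbidual.
Proof.
by move=> v; rewrite -(linfunE bidual_linear); apply: lker0_lfunK lker_bidual _.
Qed.

Lemma unbidualK : cancel unbidual bidual.
Proof.
move=> p; rewrite -(linfunE bidual_linear); apply: limg_lfunVK.
suff -> : limg (linfun bidual) = fullv by rewrite memvf.
apply/eqP; rewrite eqEdim subvf /= limg_dim_eq; last first.
  by rewrite (eqP lker_bidual) capv0.
have -> : \dim {:dual (dual V)} = (dim V * 1 * 1)%N by rewrite dimvf.
by rewrite !muln1 dimvf.
Qed.

End Dual.

(* A tensor is stored as its coordinate matrix in the bases [vbasis fullv] of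
   the factors.  [tensE] and [tens_ext] below give the universal property. *)
Definition tens (K : fieldType) (U V : vectType K) : Type :=
  'M[K]_(\dim {:U}, \dim {:V}).
HB.instance Definition _ (K : fieldType) (U V : vectType K) :=
  Vector.copy (tens U V) 'M[K]_(\dim {:U}, \dim {:V}).

Definition tprod (K : fieldType) (U V : vectType K) (u : U) (v : V) :
    tens U V :=
  \matrix_(i, j) (coord (vbasis {:U}) i u * coord (vbasis {:V}) j v).

Declare Scope tens_scope.
Delimit Scope tens_scope with T.
Notation "u ⊗ v" := (tprod u v)
  (at level 40, left associativity) : tens_scope.
Local Open Scope tens_scope.

(* The linear map on the tensor product induced by a bilinear map [b]. *)
Definition tlift (K : fieldType) (U V : vectType K) (W : lmodType K)
    (b : U -> V -> W) (t : tens U V) : W :=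
  \sum_i \sum_j t i j *: b (vbasis {:U})`_i (vbasis {:V})`_j.

Section TensorFacts.
Variables (K : fieldType) (U V : vectType K) (W : lmodType K).

Lemma tprod_bilinear : bilinear_map (@tprod K U V).
Proof.
split=> u a y z; apply/matrixP => i j; rewrite !mxE linearP.
  by rewrite mulrDr mulrCA.
by rewrite mulrDl mulrA.
Qed.

Lemma tlift_linear (b : U -> V -> W) : linear (tlift b).
Proof.
move=> a s t; rewrite /tlift scaler_sumr -big_split; apply: eq_bigr => i _ /=.
rewrite scaler_sumr -big_split; apply: eq_bigr => j _ /=.
by rewrite !mxE scalerDl scalerA.
Qed.

Lemma tensE (b : U -> V -> W) u v :
  bilinear_map b -> tlift b (u ⊗ v) = b u v.
Proof.
move=> [b_r b_l].
have sumr x n (c : 'I_n -> K) (y : 'I_n -> V) :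
    b x (\sum_i c i *: y i) = \sum_i c i *: b x (y i).
  pose F := GRing.isLinear.Build _ _ _ _ _ (b_r x).
  pose f : {linear V -> W} := HB.pack (b x) F.
  rewrite -[b x]/(f : V -> W) linear_sum.
  by apply: eq_bigr => i _; rewrite linearZ.
have suml y n (c : 'I_n -> K) (x : 'I_n -> U) :
    b (\sum_i c i *: x i) y = \sum_i c i *: b (x i) y.
  pose F := GRing.isLinear.Build _ _ _ _ _ (b_l y).
  pose f : {linear U -> W} := HB.pack (fun x => b x y) F.
  rewrite -[LHS]/(f (\sum_i c i *: x i)) linear_sum.
  by apply: eq_bigr => i _; rewrite linearZ.
rewrite [in RHS](coord_vbasis (memvf u)) suml; apply: eq_bigr => i _.
rewrite [in RHS](coord_vbasis (memvf v)) sumr scaler_sumr.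
by apply: eq_bigr => j _; rewrite mxE scalerA.
Qed.

Lemma tprod_vbasis (i : 'I_(\dim {:U})) (j : 'I_(\dim {:V})) :
  (vbasis {:U})`_i ⊗ (vbasis {:V})`_j = delta_mx i j :> 'M[K]_(_, _).
Proof.
apply/matrixP => k l; rewrite !mxE !coord_free ?(basis_free (vbasisP _)) //.
by rewrite -natrM mulnb [i == k]eq_sym [j == l]eq_sym.
Qed.

Lemma tens_ext (f g : tens U V -> W) :
  linear f -> linear g -> (forall u v, f (u ⊗ v) = g (u ⊗ v)) -> f =1 g.
Proof.
have expand (h : tens U V -> W) : linear h ->
    h =1 tlift (fun u v => h (u ⊗ v)).
  move=> h_lin t; pose F := GRing.isLinear.Build _ _ _ _ _ h_lin.
  pose h' : {linear tens U V -> W} := HB.pack h F.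
  have {1}-> : t = \sum_i \sum_j t i j *: (delta_mx i j : tens U V).
    exact: matrix_sum_delta.
  rewrite -[h]/(h' : tens U V -> W) linear_sum; apply: eq_bigr => i _.
  rewrite linear_sum; apply: eq_bigr => j _.
  by rewrite linearZ tprod_vbasis.
move=> f_lin g_lin eq_fg t; rewrite (expand f f_lin) (expand g g_lin).
by apply: eq_bigr => i _; apply: eq_bigr => j _; rewrite eq_fg.
Qed.

End TensorFacts.

Definition tmap (K : fieldType) (U V U' V' : vectType K)
    (f : U -> U') (g : V -> V') : tens U V -> tens U' V' :=
  tlift (fun u v => f u ⊗ g v).

Definition tau (K : fieldType) (U V : vectType K) : tens U V -> tens V U :=
  tlift (fun u v => v ⊗ u).

Definition tassoc (K : fieldType) (U V W : vectType K) :
    tens U (tens V W) -> tens (tens U V) W :=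
  tlift (fun u => tlift (fun v w => u ⊗ v ⊗ w)).

(* <f ⊗ g, t> *)
Definition tpair (K : fieldType) (U V : vectType K)
    (f : U -> K) (g : V -> K) (t : tens U V) : K :=
  tlift ((fun u v => f u * g v) : U -> V -> K^o) t.

Definition tens3 (K : fieldType) (A : vectType K) : Type := tens (tens A A) A.
HB.instance Definition _ (K : fieldType) (A : vectType K) :=
  Vector.copy (tens3 A) (tens (tens A A) A).

Definition xi (K : fieldType) (A : vectType K) : tens3 A -> tens3 A :=
  tlift (fun s z => tlift (fun x y => y ⊗ z ⊗ x) s).

Section Lie.
Variable K : fieldType.

Definition lie_algebra (g : lmodType K) (br : g -> g -> g) : Prop :=
  [/\ bilinear_map br,
      forall x, br x x = 0 &
      forall x y z, br x (br y z) + br y (br z x) + br z (br x y) = 0].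

Definition lie_rep (g V : lmodType K) (br : g -> g -> g)
    (rho : g -> V -> V) : Prop :=
  bilinear_map rho /\
  forall x y v, rho (br x y) v = rho x (rho y v) - rho y (rho x v).

Definition one_cocycle (g V : lmodType K) (br : g -> g -> g)
    (rho : g -> V -> V) (f : g -> V) : Prop :=
  [/\ lie_algebra br, lie_rep br rho, linear f &
      forall x y, f (br x y) = rho x (f y) - rho y (f x)].

Definition matched_pair (g h : lmodType K)
    (brg : g -> g -> g) (brh : h -> h -> h)
    (rhog : g -> h -> h) (rhoh : h -> g -> g) : Prop :=
  [/\ lie_algebra brg /\ lie_algebra brh,
      lie_rep brg rhog /\ lie_rep brh rhoh,
      forall x a b,
        rhog x (brh a b) - brh (rhog x a) b - brh a (rhog x b)
        + rhog (rhoh a x) b - rhog (rhoh b x) a = 0 &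
      forall a x y,
        rhoh a (brg x y) - brg (rhoh a x) y - brg x (rhoh a y)
        + rhoh (rhog x a) y - rhoh (rhog y a) x = 0].

End Lie.

Section AntiPreLie.
Variables (K : fieldType) (A : vectType K).

Definition sublie (m : A -> A -> A) (x y : A) : A := m x y - m y x.

Definition anti_pre_lie (m : A -> A -> A) : Prop :=
  [/\ bilinear_map m,
      forall x y z, m x (m y z) - m y (m x z) = m (sublie m y x) z &
      forall x y z,
        m (sublie m x y) z + m (sublie m y z) x + m (sublie m z x) y = 0].

(* A ⊗ A ⊗ A is [tens3 A], i.e. bracketed to the left; [(id ⊗ δ) δ] is moved
   there along the associativity isomorphism. *)
Definition anti_pre_lie_coalgebra (delta : A -> tens A A) : Prop :=
  let idd x : tens3 A := tassoc (tmap id delta (delta x)) in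
  let did x : tens3 A := tmap delta id (delta x) in
  let tau1 : tens3 A -> tens3 A := tmap (@tau K A A) id in
  [/\ linear delta,
      forall x, idd x - tau1 (idd x) = tau1 (did x) - did x &
      forall x, let w := tau1 (did x) - did x in w + xi w + xi (xi w) = 0].

Definition anti_pre_lie_bialgebra (m : A -> A -> A) (delta : A -> tens A A) :
    Prop :=
  let L x : A -> A := m x in
  let R y : A -> A := fun x => m x y in
  let ad x : A -> A := sublie m x in
  [/\ anti_pre_lie m, anti_pre_lie_coalgebra delta,
      forall x y,
        let E := delta (m x y) - tmap (L x) id (delta y)
                 - tmap id (L x) (delta y) + tmap id (R y) (delta x) in
        E - tau E = 0 &
      forall x y,
        delta (sublie m x y) =
          (tmap id (ad x) (delta y) - tmap (L x) id (delta y))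
          - (tmap id (ad y) (delta x) - tmap (L y) id (delta x))].

Definition L_ad_rep (m : A -> A -> A) (x : A) (t : tens A A) : tens A A :=
  - tmap (m x) id t + tmap id (sublie m x) t.

Definition neg_dual_L (m : A -> A -> A) (x : A) (u : dual A) : dual A :=
  - dual_rep m x u.

End AntiPreLie.

Section DualProduct.
Variables (K : fieldType) (A : vectType K).

(* - L^* for a product on the dual; it acts on the bidual and is transported
   to A. *)
Definition neg_dual_L_dual (m' : dual A -> dual A -> dual A) (a : dual A)
    (x : A) : A :=
  unbidual (neg_dual_L m' a (bidual x)).

(* <a ∘ b, x> = <a ⊗ b, delta x>; this determines [delta]. *)
Definition is_dual_of_dual_product (m' : dual A -> dual A -> dual A)
    (delta : A -> tens A A) : Prop :=
  forall (a b : dual A) x, m' a b x = tpair a b (delta x).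

(* <x ∘ y, a> = <x ⊗ y, beta a>; this determines [beta]. *)
Definition is_dual_of_product (m : A -> A -> A)
    (beta : dual A -> tens (dual A) (dual A)) : Prop :=
  forall x y (a : dual A), a (m x y) = tpair (ev x) (ev y) (beta a).

End DualProduct.

(* Main.v *)
(** Pairing a tensor equation in [A ⊗ A] with [a ⊗ b] and writing [x ▷ a] for
    [-L^*(x) a] and [a ▷ x] for the action of the dual on [A], so that
    [<x ▷ a, y> = <a, x ∘ y>] and [<b, a ▷ x> = <a ∘ b, x>], turns every condition
    into a scalar identity.  The 1-cocycle condition on [δ] becomes, term by term,
    the second matched pair equation paired with [b], and exchanging the roles
    of [A] and its dual, the condition on [β] becomes the first one.  The
    antisymmetrised bialgebra condition is also the first matched pair equation,
    paired with [y].  The coalgebra axioms for [δ] are those of the dual product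
    paired with [a ⊗ b ⊗ c]. *)

Require Import Defs.
From HB Require Import structures.
From mathcomp Require Import all_boot all_order all_algebra.
From mathcomp Require Import ring.

Set Implicit Arguments.
Unset Strict Implicit.
Unset Printing Implicit Defensive.

Import GRing.Theory.
Local Open Scope ring_scope.
Local Open Scope tens_scope.

(** * Linearity of bare functions *)

Section LinearMaps.
Variables (K : fieldType) (U V : lmodType K) (f : U -> V).
Hypothesis f_lin : linear f.

Lemma linear_fun0 : f 0 = 0.
Proof. by have := f_lin (-1) 0 0; rewrite scaler0 addr0 scaleN1r addNr. Qed.

Lemma linear_funD u v : f (u + v) = f u + f v.
Proof. by have := f_lin 1 u v; rewrite !scale1r. Qed.

Lemma linear_funZ a u : f (a *: u) = a *: f u.
Proof. by have := f_lin a u 0; rewrite !addr0 linear_fun0 addr0. Qed.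

Lemma linear_funN u : f (- u) = - f u.
Proof. by rewrite -!scaleN1r linear_funZ. Qed.

Lemma linear_funB u v : f (u - v) = f u - f v.
Proof. by rewrite linear_funD linear_funN. Qed.

End LinearMaps.

Lemma linear_comp (K : fieldType) (U V W : lmodType K)
    (f : U -> V) (g : V -> W) :
  linear f -> linear g -> linear (g \o f).
Proof. by move=> f_lin g_lin a u v; rewrite /= f_lin g_lin. Qed.

(** Reduces deriving one scalar equation from another to a polynomial identity that [ring] can
    check. *)
Lemma eq_of_subr (V : zmodType) (a b c d : V) : c = d -> a - b = c - d -> a = b.
Proof. by move=> -> /eqP; rewrite subrr subr_eq0 => /eqP. Qed.

(** Injectivity of the map to the bidual; it turns vector identities into scalar ones, where [ring]
    applies. *)
Lemma dual_separates (K : fieldType) (V : vectType K) (u v : V) :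
  (forall f : dual V, f u = f v) -> u = v.
Proof.
move=> eq_uv; apply: (can_inj (@bidualK K V)); apply/lfunP => f.
by rewrite !bidualE.
Qed.

(** * Pairings and maps of tensors *)

Section TensorPairing.
Variables (K : fieldType) (U V : vectType K).

Lemma tpair_linear (f : U -> K) (g : V -> K) :
  linear (tpair f g : tens U V -> K^o).
Proof. exact: tlift_linear. Qed.

Lemma tpair_tprod (f : U -> K) (g : V -> K) u v :
  linear (f : U -> K^o) -> linear (g : V -> K^o) ->
  tpair f g (u ⊗ v) = f u * g v.
Proof.
move=> f_lin g_lin.
apply: (@tensE K U V K^o (fun u v => f u * g v)); split=> w a y z.
  by rewrite g_lin /GRing.scale /=; ring.
by rewrite f_lin /GRing.scale /=; ring.
Qed.

Lemma eq_tpair (f f' : U -> K) (g g' : V -> K) :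
  f =1 f' -> g =1 g' -> tpair f g =1 tpair f' g'.
Proof.
move=> eq_f eq_g t; apply: eq_bigr => i _; apply: eq_bigr => j _.
by rewrite eq_f eq_g.
Qed.

(** The coordinate functionals of the two bases already extract every matrix entry. *)
Lemma tpair_ext (s t : tens U V) :
  (forall (f : dual U) (g : dual V), tpair f g s = tpair f g t) -> s = t.
Proof.
move=> eq_st; apply/matrixP => i j.
pose f : dual U := linfun (coord (vbasis fullv) i : {linear U -> K^o}).
pose g : dual V := linfun (coord (vbasis fullv) j : {linear V -> K^o}).
have expand (r : tens U V) : tpair f g r = r i j.
  rewrite /tpair /tlift (bigD1 i) //= (bigD1 j) //= big1 => [|l neq_lj].
    rewrite big1 => [|k neq_ki]; last first.
      apply: big1 => l _; rewrite lfunE /= coord_free.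
        by rewrite (negPf neq_ki) mul0r scaler0.
      exact: (basis_free (vbasisP _)).
    rewrite !lfunE /= !coord_free ?(basis_free (vbasisP _)) // !eqxx.
    by rewrite !addr0 mul1r /GRing.scale /= mulr1.
  rewrite !lfunE /= !coord_free ?(basis_free (vbasisP _)) //.
  by rewrite (negPf neq_lj) mulr0 scaler0.
by rewrite -!expand.
Qed.

(** Linearity in a parameter of the bilinear map, not in the tensor, as needed for the nested lifts
    in [tassoc] and [xi]. *)
Lemma tlift_linear_family (g W : lmodType K) (b : g -> U -> V -> W)
    (t : tens U V) :
  (forall u v, linear (fun x => b x u v)) -> linear (fun x => tlift (b x) t).
Proof.
move=> b_lin a x y; rewrite /tlift scaler_sumr -big_split.
apply: eq_bigr => i _; rewrite /= scaler_sumr -big_split; apply: eq_bigr => j _ /=.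
by rewrite b_lin scalerDr !scalerA mulrC.
Qed.

End TensorPairing.

Lemma tpair_tau (K : fieldType) (U V : vectType K) (f : V -> K)
    (g : U -> K) (t : tens U V) :
  linear (f : V -> K^o) -> linear (g : U -> K^o) ->
  tpair f g (tau t) = tpair g f t.
Proof.
move=> f_lin g_lin; move: t.
apply: (@tens_ext K U V K^o) => [a s t||u v].
- exact: (@linear_comp K (tens U V) (tens V U) K^o _ (tpair f g)
    (tlift_linear _) (tlift_linear _)).
- exact: tpair_linear.
rewrite /tau tensE; last by case: (tprod_bilinear V U).
by rewrite !tpair_tprod // mulrC.
Qed.

Section TensorMaps.
Variables (K : fieldType) (U V U' V' : vectType K).

Lemma tmap_linear (f : U -> U') (g : V -> V') : linear (tmap f g).
Proof. exact: tlift_linear. Qed.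

Lemma tmap_tprod (f : U -> U') (g : V -> V') u v :
  linear f -> linear g -> tmap f g (u ⊗ v) = f u ⊗ g v.
Proof.
move=> f_lin g_lin; have [tr tl] := tprod_bilinear U' V'.
by apply: tensE; split=> w a y z; rewrite ?g_lin ?tr ?f_lin ?tl.
Qed.

Lemma tpair_tmap (f : U -> U') (g : V -> V') (p : U' -> K) (q : V' -> K) t :
  linear f -> linear g -> linear (p : U' -> K^o) -> linear (q : V' -> K^o) ->
  tpair p q (tmap f g t) = tpair (p \o f) (q \o g) t.
Proof.
move=> f_lin g_lin p_lin q_lin; move: t.
apply: (@tens_ext K U V K^o) => [a s t||u v].
- exact: (@linear_comp K (tens U V) (tens U' V') K^o _ (tpair p q)
    (tlift_linear _) (tlift_linear _)).
- exact: tpair_linear.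
rewrite tmap_tprod // !tpair_tprod //= => a x y /=.
  by rewrite f_lin p_lin.
by rewrite g_lin q_lin.
Qed.

End TensorMaps.

(** * The sub-adjacent Lie algebra and its representations *)

Section AntiPreLieTheory.
Variables (K : fieldType) (A : vectType K) (m : A -> A -> A).
Hypothesis hm : anti_pre_lie m.

Lemma apl_linear x : linear (m x).
Proof. by case: hm => -[]. Qed.

Lemma apl_linear_l y : linear (fun x => m x y).
Proof. by case: hm => -[]. Qed.

Lemma sublie_bilinear : bilinear_map (sublie m).
Proof.
split=> x a y z; rewrite /sublie apl_linear (apl_linear_l x) scalerBr;
  by rewrite opprD addrACA.
Qed.

Lemma sublieC x y : sublie m y x = - sublie m x y.
Proof. by rewrite opprB. Qed.

(** Summing the first axiom cyclically gives [x∘[y,z] + ... = -([x,y]∘z + ...)], so the Jacobi sum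
    is minus twice the cyclic sum, which the second axiom makes zero. *)
Lemma sublie_lie_algebra : lie_algebra (sublie m).
Proof.
split=> [|x|x y z]; [exact: sublie_bilinear | exact: subrr |].
case: hm => _ comm cyc; apply: dual_separates => f.
have := congr1 f (comm x y z); have := congr1 f (comm y z x).
have := congr1 f (comm z x y); have := congr1 f (cyc x y z).
rewrite /sublie !(linear_funB (apl_linear_l _)) !(linear_funB (apl_linear _)).
rewrite !(linearD, linearB) linear0 => e1 e2 e3 e4.
apply: (eq_of_subr (congr2 +%R (congr2 +%R e2 e3)
  (congr2 +%R e4 (congr1 (fun u => - u - u) e1)))).
by rewrite /=; ring.
Qed.

(** The first axiom has [[y,x]] on the right, so left multiplication represents the opposite bracket
    and its negative represents the bracket. *)
Lemma opp_mul_lie_rep : lie_rep (sublie m) (fun x y => - m x y).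
Proof.
split=> [|x y z].
  by split=> u a y z; rewrite ?apl_linear ?(apl_linear_l u) opprD scalerN.
have [_ comm _] := hm.
rewrite !(linear_funN (apl_linear _)) !opprK comm.
by rewrite sublieC (linear_funN (apl_linear_l _)) opprK.
Qed.

Lemma ad_lie_rep : lie_rep (sublie m) (sublie m).
Proof.
split=> [|x y z]; first exact: sublie_bilinear.
have [[br_r _] _ jacobi] := sublie_lie_algebra.
rewrite sublieC [sublie m x z]sublieC (linear_funN (br_r y)) opprK.
by apply/eqP; rewrite eq_sym -addr_eq0 jacobi.
Qed.

End AntiPreLieTheory.

(** The mixed terms [r x u ⊗ s y v] cancel in the commutator of two tensor actions; pure tensors
    suffice. *)
Lemma tensor_lie_rep (K : fieldType) (g U V : vectType K) (br : g -> g -> g)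
    (r : g -> U -> U) (s : g -> V -> V) :
  lie_rep br r -> lie_rep br s ->
  lie_rep br (fun x t => tmap (r x) id t + tmap id (s x) t).
Proof.
move=> [[r_lin r_lin_l] r_br] [[s_lin s_lin_l] s_br].
have [tr tl] := tprod_bilinear U V.
have act_lin x : linear (fun t => tmap (r x) id t + tmap id (s x) t).
  by move=> a t t'; rewrite !tmap_linear scalerDr addrACA.
have actE x u v : tmap (r x) id (u ⊗ v) + tmap id (s x) (u ⊗ v)
    = r x u ⊗ v + u ⊗ s x v.
  by rewrite !tmap_tprod.
split=> [|x y]; first split=> [//|t a x y].
  move: t; apply: tens_ext => [//|b t t'|u v].
    by rewrite !act_lin !scalerDr !scalerA mulrC addrACA.
  by rewrite !actE r_lin_l s_lin_l tr tl scalerDr addrACA.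
apply: tens_ext => [//|b t t'|u v].
  by rewrite !act_lin scalerBr opprD addrACA.
rewrite !actE !(linear_funD (act_lin _)) !actE r_br s_br.
rewrite (linear_funB (tl _)) (linear_funB (tr _)).
apply: dual_separates => f; rewrite !(linearD, linearB, linearN) /=; ring.
Qed.

(** Since [-(L ⊗ id) = (-L) ⊗ id], this is the tensor product of the representations [-L] and
    [ad]. *)
Lemma L_ad_lie_rep (K : fieldType) (A : vectType K) (m : A -> A -> A) :
  anti_pre_lie m -> lie_rep (sublie m) (L_ad_rep m).
Proof.
move=> hm; have tmapN x (t : tens A A) :
    - tmap (m x) id t = tmap (fun y => - m x y) id t.
  move: t; apply: tens_ext => [a s t|a s t|u v].
  - by rewrite tmap_linear opprD scalerN.
  - exact: tmap_linear.
  have mN_lin : linear (fun y => - m x y).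
    by move=> a y z; rewrite apl_linear // opprD scalerN.
  rewrite !tmap_tprod //; last exact: apl_linear.
  by have [_ tl] := tprod_bilinear A A; rewrite (linear_funN (tl v)).
have [[r_lin l_lin] rep] :=
  tensor_lie_rep (opp_mul_lie_rep hm) (ad_lie_rep hm).
split=> [|x y t]; last by rewrite /L_ad_rep !tmapN rep.
by split=> u a y z; rewrite /L_ad_rep !tmapN ?r_lin ?l_lin.
Qed.

(** * Products, actions and coproducts in perfect duality *)

(* An abstract pairing, because it is applied both to [A] with its dual and to
   the dual with [A], which avoids the bidual. *)
Section PerfectPairing.
Variables (K : fieldType) (A B : vectType K) (p : A -> B -> K).
Hypothesis p_linl : forall b, linear (p^~ b : A -> K^o).
Hypothesis p_linr : forall a, linear (p a : B -> K^o).
(** [p_repr] and [p_sep] make [b ↦ p^~ b] surjective and injective, so [B] is a copy of the dual of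
    [A]. *)
Hypothesis p_repr : forall f : dual A, exists b, f =1 p^~ b.
Hypothesis p_sep : forall b c, (forall x, p x b = p x c) -> b = c.

Lemma pairing_sep x y : (forall b, p x b = p y b) -> x = y.
Proof.
move=> eq_xy; apply: dual_separates => f.
by have [b fE] := p_repr f; rewrite !fE.
Qed.

Lemma pairing_tens_sep (s t : tens A A) :
  (forall a b, tpair (p^~ a) (p^~ b) s = tpair (p^~ a) (p^~ b) t) -> s = t.
Proof.
move=> eq_st; apply: tpair_ext => f g.
have [a fE] := p_repr f; have [b gE] := p_repr g.
have fgE : tpair f g =1 tpair (p^~ a) (p^~ b) by apply: eq_tpair.
by rewrite !fgE.
Qed.

Variables (m : A -> A -> A) (n : B -> B -> B).
Variables (actA : A -> B -> B) (actB : B -> A -> A) (delta : A -> tens A A).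
Hypothesis m_apl : anti_pre_lie m.
Hypothesis n_apl : anti_pre_lie n.
Hypothesis actAE : forall x y b, p y (actA x b) = p (m x y) b.
Hypothesis actBE : forall x a b, p (actB a x) b = p x (n a b).
Hypothesis deltaE :
  forall x a b, tpair (p^~ a) (p^~ b) (delta x) = p x (n a b).

Lemma pairingDl x y b : p (x + y) b = p x b + p y b.
Proof. exact: (linear_funD (p_linl b)). Qed.

Lemma pairingNl x b : p (- x) b = - p x b.
Proof. exact: (linear_funN (p_linl b)). Qed.

Lemma pairingDr x a b : p x (a + b) = p x a + p x b.
Proof. exact: (linear_funD (p_linr x)). Qed.

Lemma pairingNr x b : p x (- b) = - p x b.
Proof. exact: (linear_funN (p_linr x)). Qed.

Lemma pairing0l b : p 0 b = 0.
Proof. exact: (linear_fun0 (p_linl b)). Qed.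

Lemma pairing0r x : p x 0 = 0.
Proof. exact: (linear_fun0 (p_linr x)). Qed.

Lemma pairingZl c x b : p (c *: x) b = c * p x b.
Proof. exact: (linear_funZ (p_linl b)). Qed.

Lemma pairingZr c x b : p x (c *: b) = c * p x b.
Proof. exact: (linear_funZ (p_linr x)). Qed.

Definition pairingE :=
  (pairingDl, pairingNl, pairingDr, pairingNr, pairing0l, pairing0r,
   pairingZl, pairingZr).

Lemma pairing_tensD a b s t : tpair (p^~ a) (p^~ b) (s + t) =
  tpair (p^~ a) (p^~ b) s + tpair (p^~ a) (p^~ b) t.
Proof. exact: (linear_funD (@tpair_linear K A A (p^~ a) (p^~ b))). Qed.

Lemma pairing_tensN a b t :
  tpair (p^~ a) (p^~ b) (- t) = - tpair (p^~ a) (p^~ b) t.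
Proof. exact: (linear_funN (@tpair_linear K A A (p^~ a) (p^~ b))). Qed.

Lemma pairing_tens0 a b : tpair (p^~ a) (p^~ b) 0 = 0.
Proof. exact: (linear_fun0 (@tpair_linear K A A (p^~ a) (p^~ b))). Qed.

Lemma dual_coproduct_linear : linear delta.
Proof.
move=> c x y; apply: pairing_tens_sep => a b.
rewrite pairing_tensD (linear_funZ (@tpair_linear K A A (p^~ a) (p^~ b))).
by rewrite !deltaE (p_linl _ c).
Qed.

(** Transposition reverses composition, and the first axiom reverses the bracket; the two reversals
    compensate, leaving no sign. *)
Lemma pairing_act_lie_rep : lie_rep (sublie m) actA.
Proof.
split=> [|x y b]; first split=> u a v w; apply: p_sep => z.
- by rewrite !pairingE !actAE !pairingE.
- by rewrite !pairingE !actAE (apl_linear_l m_apl z) !pairingE.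
have [_ comm _] := m_apl.
by rewrite !pairingE !actAE -comm !pairingE.
Qed.

Lemma pairing_delta_mull a b x y :
  tpair (p^~ a) (p^~ b) (tmap (m x) id (delta y)) = p y (n (actA x a) b).
Proof.
rewrite tpair_tmap //; last exact: apl_linear.
by rewrite -deltaE; apply: eq_tpair => // z /=; rewrite actAE.
Qed.

(** Contracting the left factor of [delta y] with [a] leaves [actB a y]. No transpose of [g] on [B]
    is given, so [p_repr] supplies a [c] representing [z ↦ p (g z) b]. *)
Lemma pairing_delta_mapr (g : A -> A) a b y : linear g ->
  tpair (p^~ a) (p^~ b) (tmap id g (delta y)) = p (g (actB a y)) b.
Proof.
move=> g_lin; rewrite tpair_tmap //.
have f_lin : linear (fun z => p (g z) b : K^o).
  by move=> c z z'; rewrite g_lin p_linl.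
have [c cE] := p_repr (linfun (fun z => p (g z) b : K^o) : dual A).
have pgE z : p (g z) b = p z c by rewrite -cE linfunE.
rewrite pgE actBE -deltaE; exact: eq_tpair.
Qed.

(** * Triple tensors and the coalgebra axioms *)

Definition tpair3 a b c (t : tens3 A) : K :=
  tpair (tpair (p^~ a) (p^~ b)) (p^~ c) t.

Lemma tpair3_linear a b c : linear (tpair3 a b c : tens3 A -> K^o).
Proof. exact: tlift_linear. Qed.

Lemma tpair3_tprod a b c x y z :
  tpair3 a b c (x ⊗ y ⊗ z) = p x a * p y b * p z c.
Proof. by rewrite /tpair3 !tpair_tprod //; exact: tpair_linear. Qed.

(** A functional on [A ⊗ A] need not be a product, so [slice c] contracts the last factor with [c];
    the slices agree by separation on [A ⊗ A] and determine every pairing. *)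
Lemma tpair3_sep (s t : tens3 A) :
  (forall a b c, tpair3 a b c s = tpair3 a b c t) -> s = t.
Proof.
pose slice c (t : tens3 A) : tens A A := tlift (fun r z => p z c *: r) t.
have sliceE (f : tens A A -> K) c r : linear (f : tens A A -> K^o) ->
    tpair f (p^~ c) r = f (slice c r).
  move=> f_lin; move: r.
  apply: (@tens_ext K (tens A A) A K^o) => [|a r r'|r z].
  - exact: tpair_linear.
  - by rewrite /slice tlift_linear f_lin.
  rewrite tpair_tprod // /slice tensE.
    by rewrite (linear_funZ f_lin) mulrC.
  split=> u a v w; first by rewrite p_linl scalerDl scalerA.
  by rewrite scalerDr !scalerA mulrC.
move=> eq_st; have eq_slice c : slice c s = slice c t.
  apply: pairing_tens_sep => a b.
  by rewrite -!sliceE; [exact: eq_st | exact: tpair_linear..].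
apply: tpair_ext => f g; have [c gE] := p_repr g.
have fgE : tpair f g =1 tpair f (p^~ c) by apply: eq_tpair.
by rewrite !fgE !sliceE ?eq_slice // => a u v; rewrite linearP.
Qed.

Lemma tpair3_assoc a b c (t : tens A (tens A A)) :
  tpair3 a b c (tassoc t) = tpair (p^~ a) (tpair (p^~ b) (p^~ c)) t.
Proof.
move: t; have [tr tl] := tprod_bilinear A A.
have [tr3 tl3] := tprod_bilinear (tens A A) A.
have assoc_bil : bilinear_map
    (fun u => tlift (fun v w => u ⊗ v ⊗ w) : tens A A -> tens3 A).
  split=> [u|t]; first exact: tlift_linear.
  by apply: tlift_linear_family => v w k u u'; rewrite tl tl3.
apply: (@tens_ext K A (tens A A) K^o) => [k t t'||u t].
- by rewrite /tassoc tlift_linear tpair3_linear.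
- exact: tpair_linear.
rewrite /tassoc tensE // tpair_tprod //; last exact: tpair_linear.
move: t; apply: (@tens_ext K A A K^o) => [k t t'|k t t'|v w].
- by rewrite tlift_linear tpair3_linear.
- by rewrite tpair_linear scalerAr mulrDr.
rewrite tensE; first by rewrite tpair3_tprod tpair_tprod // mulrA.
by split=> v' k t t'; rewrite ?tr ?tr3 ?tl3.
Qed.

Lemma tpair3_tau a b c (t : tens3 A) :
  tpair3 a b c (tmap (@tau K A A) id t) = tpair3 b a c t.
Proof.
rewrite /tpair3 tpair_tmap //; first 1 last.
- exact: tlift_linear.
- exact: tpair_linear.
by apply: eq_tpair => // s /=; rewrite tpair_tau.
Qed.

(** The transpose of a cyclic rotation is the inverse rotation, hence the order [c], [a], [b]. *)
Lemma tpair3_xi a b c (t : tens3 A) : tpair3 a b c (xi t) = tpair3 c a b t.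
Proof.
move: t; have [tr tl] := tprod_bilinear A A.
have [tr3 tl3] := tprod_bilinear (tens A A) A.
apply: (@tens_ext K (tens A A) A K^o) => [k t t'||s z].
- by rewrite /xi tlift_linear tpair3_linear.
- exact: tpair_linear.
rewrite /xi tensE; last first.
  split=> [s' |z']; last exact: tlift_linear.
  by apply: tlift_linear_family => v w k u u'; rewrite tr tl3.
move: s; apply: (@tens_ext K A A K^o) => [k t t'|k t t'|x y].
- by rewrite tlift_linear tpair3_linear.
- by rewrite tl3 tpair3_linear.
rewrite tensE; first by rewrite !tpair3_tprod mulrC mulrA.
by split=> v k u w; rewrite ?tr3 // tl tl3.
Qed.

(** With [∘] for [n], the iterated coproducts [(id ⊗ δ) δ] and [(δ ⊗ id) δ] are the transposes of
    [a∘(b∘c)] and [(a∘b)∘c]. *)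
Lemma dual_coproduct_coalgebra : anti_pre_lie_coalgebra delta.
Proof.
have iddE a b c x :
    tpair3 a b c (tassoc (tmap id delta (delta x))) = p x (n a (n b c)).
  rewrite tpair3_assoc tpair_tmap //; first 1 last.
  - exact: dual_coproduct_linear.
  - exact: tpair_linear.
  by rewrite -deltaE; apply: eq_tpair => // y /=; rewrite deltaE.
have didE a b c x :
    tpair3 a b c (tmap delta id (delta x)) = p x (n (n a b) c).
  rewrite /tpair3 tpair_tmap //; first 1 last.
  - exact: dual_coproduct_linear.
  - exact: tpair_linear.
  by rewrite -deltaE; apply: eq_tpair => // y /=; rewrite deltaE.
have tpair3D a b c s t : tpair3 a b c (s + t) = tpair3 a b c s + tpair3 a b c t.
  exact: (linear_funD (tpair3_linear a b c)).
have tpair3N a b c t : tpair3 a b c (- t) = - tpair3 a b c t.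
  exact: (linear_funN (tpair3_linear a b c)).
have [_ comm cyc] := n_apl.
split=> [|x|x w]; first exact: dual_coproduct_linear.
  apply: tpair3_sep => a b c.
  rewrite !(tpair3D, tpair3N) !tpair3_tau !iddE !didE.
  rewrite -!pairingNr -!pairingDr comm.
  by rewrite (linear_funB (apl_linear_l n_apl c)).
have wE a' b' c' : tpair3 a' b' c' w = - p x (n (sublie n a' b') c').
  rewrite !(tpair3D, tpair3N) !tpair3_tau !didE.
  by rewrite (linear_funB (apl_linear_l n_apl c')) !pairingE opprB.
(* Only the pairings of [w] matter now: the rotations permute [a], [b], [c] and yield the three
   terms of the second axiom. *)
clearbody w; apply: tpair3_sep => a b c; rewrite !tpair3D !tpair3_xi.
have -> : tpair3 a b c 0 = 0 by exact: (linear_fun0 (tpair3_linear a b c)).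
by rewrite !wE -!opprD -!pairingDr addrAC cyc !pairingE oppr0.
Qed.

(** * Compatibility conditions as matched pair equations *)

(** Left multiplication on the first factor gives the terms [actB (actA x a) y] and
    [actB (actA y a) x]; [ad] on the second factor gives the brackets with [actB]. *)
Lemma cocycle_eq_iff_matched_pair_eq :
  (forall x y, delta (sublie m x y)
     = L_ad_rep m x (delta y) - L_ad_rep m y (delta x)) <->
  (forall a x y, actB a (sublie m x y) - sublie m (actB a x) y
     - sublie m x (actB a y) + actB (actA x a) y - actB (actA y a) x = 0).
Proof.
have ad_lin x : linear (sublie m x) by case: (sublie_bilinear m_apl).
have pairE a b x y :
    tpair (p^~ a) (p^~ b) (delta (sublie m x y)
      - (L_ad_rep m x (delta y) - L_ad_rep m y (delta x)))
    = p (actB a (sublie m x y) - sublie m (actB a x) y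
     - sublie m x (actB a y) + actB (actA x a) y - actB (actA y a) x) b.
  rewrite /L_ad_rep !(pairing_tensD, pairing_tensN) !pairing_delta_mull.
  rewrite !pairing_delta_mapr // deltaE -!actBE !pairingE.
  ring.
split=> eq0 => [a x y | x y].
  by apply: pairing_sep => b; rewrite -pairE eq0 subrr pairing_tens0 pairing0l.
apply/eqP; rewrite -subr_eq0; apply/eqP; apply: pairing_tens_sep => a b.
by rewrite pairE eq0 pairing_tens0 pairing0l.
Qed.

(** In the pairing with [a ⊗ b], [tau] exchanges [a] and [b], so the antisymmetrisation turns the
    products of [n] into brackets. *)
Lemma antisymmetric_eq_iff_matched_pair_eq :
  (forall x y,
     let E := delta (m x y) - tmap (m x) id (delta y)
       - tmap id (m x) (delta y) + tmap id (fun z => m z y) (delta x) in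
     E - tau E = 0) <->
  (forall x a b, actA x (sublie n a b) - sublie n (actA x a) b
     - sublie n a (actA x b) + actA (actB a x) b - actA (actB b x) a = 0).
Proof.
have pairE a b x y :
    let E := delta (m x y) - tmap (m x) id (delta y)
      - tmap id (m x) (delta y) + tmap id (fun z => m z y) (delta x) in
    tpair (p^~ a) (p^~ b) (E - tau E)
    = p y (actA x (sublie n a b) - sublie n (actA x a) b
        - sublie n a (actA x b) + actA (actB a x) b - actA (actB b x) a).
  rewrite /= pairing_tensD pairing_tensN tpair_tau //.
  rewrite !(pairing_tensD, pairing_tensN) !pairing_delta_mull.
  rewrite !(pairing_delta_mapr, deltaE); try exact: apl_linear; last first.
  - exact: apl_linear_l.
  - exact: apl_linear_l.
  (* The terms from [id ⊗ L] are transposed back onto the dual side, so that [actB] comes outermost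
     and [actBE] applies. *)
  rewrite /sublie !pairingE !actAE !pairingE -![p (m x (actB _ _)) _]actAE.
  rewrite !actBE.
  ring.
split=> eq0 => [x a b | x y].
  by apply: p_sep => y; rewrite -pairE eq0 pairing_tens0 pairing0r.
apply: pairing_tens_sep => a b.
by rewrite pairE eq0 pairing_tens0 pairing0r.
Qed.

End PerfectPairing.

(** * Instantiation at a space and its dual *)

Lemma neg_dual_LE (K : fieldType) (A : vectType K) (m : A -> A -> A) x
    (u : dual A) y :
  anti_pre_lie m -> neg_dual_L m x u y = u (m x y).
Proof.
by move=> m_apl; rewrite opp_lfunE dual_repE ?opprK //; apply: apl_linear.
Qed.

Lemma neg_dual_L_dualE (K : fieldType) (A : vectType K)
    (n : dual A -> dual A -> dual A) (a b : dual A) x :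
  anti_pre_lie n -> b (neg_dual_L_dual n a x) = n a b x.
Proof.
by move=> n_apl; rewrite -bidualE unbidualK neg_dual_LE // bidualE.
Qed.

Lemma anti_pre_lie_bialgebra_equivalences (K : fieldType) (A : vectType K)
    (mulA : A -> A -> A) (mulD : dual A -> dual A -> dual A)
    (hA : anti_pre_lie mulA) (hD : anti_pre_lie mulD)
    (delta : A -> tens A A) (beta : dual A -> tens (dual A) (dual A))
    (hdelta : is_dual_of_dual_product mulD delta)
    (hbeta : is_dual_of_product mulA beta) :
  (anti_pre_lie_bialgebra mulA delta
   <-> one_cocycle (sublie mulA) (L_ad_rep mulA) delta
       /\ one_cocycle (sublie mulD) (L_ad_rep mulD) beta)
  /\ (one_cocycle (sublie mulA) (L_ad_rep mulA) delta
      /\ one_cocycle (sublie mulD) (L_ad_rep mulD) beta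
      <-> matched_pair (sublie mulA) (sublie mulD)
            (neg_dual_L mulA) (neg_dual_L_dual mulD)).
Proof.
(* Evaluation with its arguments in either order: [p] pairs [A] with its dual, [q] the dual with
   [A]. *)
pose p (x : A) (a : dual A) : K := a x.
pose q (a : dual A) (x : A) : K := a x.
have eval_lin (a : dual A) : linear ((fun x : A => a x) : A -> K^o).
  by move=> k x y; rewrite linearP.
have ev_lin x : linear ((fun a : dual A => a x) : dual A -> K^o).
  by move=> k a b; rewrite add_lfunE scale_lfunE.
have p_repr (f : dual A) : exists b, f =1 p^~ b by exists f.
have q_repr (f : dual (dual A)) : exists x, f =1 q^~ x.
  by exists (unbidual f) => a; rewrite /q -[RHS]bidualE unbidualK.
have p_sep (b c : dual A) : (forall x, p x b = p x c) -> b = c.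
  by move=> eq_bc; apply/lfunP.
have q_sep (x y : A) : (forall a, q a x = q a y) -> x = y.
  exact: dual_separates.
have actA x y (b : dual A) : p y (neg_dual_L mulA x b) = p (mulA x y) b.
  exact: neg_dual_LE.
have actD x (a b : dual A) : p (neg_dual_L_dual mulD a x) b = p x (mulD a b).
  exact: neg_dual_L_dualE.
have deltaE x a b : tpair (p^~ a) (p^~ b) (delta x) = p x (mulD a b).
  by rewrite /p hdelta.
have betaE a x y : tpair (q^~ x) (q^~ y) (beta a) = q a (mulA x y).
  by rewrite /q hbeta.
have qactA a x y : q (neg_dual_L mulA x a) y = q a (mulA x y) by exact: actA.
have qactD (a b : dual A) x : q b (neg_dual_L_dual mulD a x) = q (mulD a b) x.
  exact: actD.
have delta_iff :=
  cocycle_eq_iff_matched_pair_eq (p := p) eval_lin p_repr hA actA actD deltaE.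
(* The two actions exchange roles here, so the second matched pair equation of this instance is the
   first one of the original pair. *)
have beta_iff :=
  cocycle_eq_iff_matched_pair_eq (p := q) ev_lin q_repr hD qactD qactA betaE.
have anti_iff := antisymmetric_eq_iff_matched_pair_eq (p := p)
  eval_lin ev_lin p_repr p_sep hA actA actD deltaE.
have delta_lin := dual_coproduct_linear (p := p) eval_lin p_repr deltaE.
have beta_lin := dual_coproduct_linear (p := q) ev_lin q_repr betaE.
have repA := pairing_act_lie_rep (p := p) eval_lin ev_lin p_sep hA actA.
have repD := pairing_act_lie_rep (p := q) ev_lin eval_lin q_sep hD qactD.
have coalg :=
  dual_coproduct_coalgebra (p := p) eval_lin ev_lin p_repr hD deltaE.
have lieA := sublie_lie_algebra hA; have lieD := sublie_lie_algebra hD.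
have L_adA := L_ad_lie_rep hA; have L_adD := L_ad_lie_rep hD.
split; split.
- case=> _ _ anti cocyc; split; split=> //.
    by move=> x y; rewrite cocyc /L_ad_rep ![- tmap _ _ _ + _]addrC.
  (* Both conditions are equivalent to the same matched pair equation. *)
  exact/beta_iff/anti_iff.
- case=> -[_ _ _ cocycA] [_ _ _ cocycD]; split=> //.
    exact/anti_iff/beta_iff.
  by move=> x y; rewrite cocycA /L_ad_rep ![- tmap _ _ _ + _]addrC.
- case=> -[_ _ _ cocycA] [_ _ _ cocycD]; split=> //.
    exact/beta_iff.
  exact/delta_iff.
by case=> _ _ mpA mpD; split; split=> //; [exact/delta_iff|exact/beta_iff].
Qed.

Theorem theorem2p15 (K : closedFieldType) (charK : [pchar K] =i pred0)
    (A : vectType K)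
    (mulA : A -> A -> A) (mulD : dual A -> dual A -> dual A)
    (hA : anti_pre_lie mulA) (hD : anti_pre_lie mulD)
    (delta : A -> tens A A) (beta : dual A -> tens (dual A) (dual A))
    (hdelta : is_dual_of_dual_product mulD delta)
    (hbeta : is_dual_of_product mulA beta) :
  (anti_pre_lie_bialgebra mulA delta
   <-> one_cocycle (sublie mulA) (L_ad_rep mulA) delta
       /\ one_cocycle (sublie mulD) (L_ad_rep mulD) beta)
  /\ (one_cocycle (sublie mulA) (L_ad_rep mulA) delta
      /\ one_cocycle (sublie mulD) (L_ad_rep mulD) beta
      <-> matched_pair (sublie mulA) (sublie mulD)
            (neg_dual_L mulA) (neg_dual_L_dual mulD)).
Proof. exact: anti_pre_lie_bialgebra_equivalences. Qed.
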